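(* Let $U$ and $X$ be normed spaces, $S: X \rightrightarrows U$ a set-valued mapping, $J: U \to \mathbb{R}$, and $x \in X$. In (ii) and (iii), $\mathrm{Sup}_{J\circ S}$ is regarded as a function $X\to(-\infty,\infty]$ (that is, $S$ has nonempty values). Then the following hold: (i) If $S^\sharp(x)$ is non-empty and $J$ is continuously differentiable near every point of $S^\sharp(x)$, then $$\partial_F \mathrm{Inf}_{J\circ S}(x) \subset \bigcap_{u \in S^\sharp(x)} \widehat D^* S(x|u)(J'(u)).$$ (ii) If $S$ is inner Lipschitz at $x$ relative to a set $A \subset S^\flat(x)\subset S(x)$, then $$\bigcup_{u \in A,\ u^* \in \partial_F J(u)} \widehat D^* S(x|u)(u^* ) \subset \partial_F \mathrm{Sup}_{J\circ S}(x).$$ (iii) If $S$ is inner semi-Lipschitz at $x$ relative to a set $A \subset S^\flat(x)\subset S(x)$, then $$\bigcap_{u \in A}\ \bigcup_{u^* \in \partial_F J(u)} \widehat D^* S(x|u)(u^* ) \subset \partial_F \mathrm{Sup}_{J\circ S}(x).$$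
   Context: Optimistic and pessimistic selections: $\mathrm{Inf}_{J\circ S}(x)=\inf\{J(u)\mid u\in S(x)\}$ and $\mathrm{Sup}_{J\circ S}(x)=\sup\{J(u)\mid u\in S(x)\}$. Also $S^\sharp(x)=\{u\in S(x)\mid J(u)=\mathrm{Inf}_{J\circ S}(x)\}$ and $S^\flat(x)=\{u\in S(x)\mid J(u)=\mathrm{Sup}_{J\circ S}(x)\}$. Fréchet subdifferential of $F:X\to(-\infty,\infty]$ at $x$ with $F(x)$ finite: $\partial_F F(x)=\{x^*\in X^*\mid \liminf_{\tilde x\to x}\frac{F(\tilde x)-F(x)-\langle x^*|\tilde x-x\rangle}{\|\tilde x-x\|}\ge 0\}$. The same formula defines $\partial_F J(u)\subset U^*$. Fréchet coderivative of $F:X\rightrightarrows Y$ at $x$ for $y$: for $y^*\in Y^*$, $$\widehat D^*F(x|y)(y^* )=\Bigl\{x^*\in X^*\Bigm| \limsup_{\tilde x\to x,\ F(\tilde x)\ni\tilde y\to y}\frac{\langle x^*|\tilde x-x\rangle-\langle y^*|\tilde y-y\rangle}{\|\tilde x-x\|+\|\tilde y-y\|}\le 0\Bigr\}.$$ $\mathrm{dom}\,F=\{x\mid F(x)\neq\emptyset\}$ for set-valued $F$; $\mathrm{dist}(B,a)=\inf_{b\in B}\|a-b\|$. $F:X\rightrightarrows Y$ is inner Lipschitz at $x$ relative to $A\subset Y$ if for every $y\in A$ there exist $\lambda_y\ge0$ and $\rho_y>0$ with $\mathrm{dist}(F(\tilde x),y)\le\lambda_y\|x-\tilde x\|$ for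 all $\tilde x\in B(x,\rho_y)\cap\mathrm{dom}\,F$. It is inner semi-Lipschitz at $x$ relative to $A$ if, for every sequence $\mathrm{dom}\,F\ni x^k\to x$, there exist a subsequence (not relabelled), some $y\in A$, and $\lambda_y\ge 0$ with $\mathrm{dist}(F(x^k),y)\le\lambda_y\|x-x^k\|$ for all $k$. *)

(* Defs.v *)
From mathcomp Require Import all_boot all_order all_algebra.
From mathcomp Require Import all_classical all_reals all_analysis.

Set Implicit Arguments.
Unset Strict Implicit.
Unset Printing Implicit Defensive.
Import Order.TTheory GRing.Theory Num.Theory.
Import numFieldNormedType.Exports.
Local Open Scope classical_set_scope.
Local Open Scope ring_scope.

(* The topological dual X^* is the set [dual] of continuous elements of
   {linear X -> R^o}; subsets of X^* are subsets of {linear X -> R^o}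
   that are contained in [dual]. *)
Definition dual (R : realType) (X : normedModType R) :
  set {linear X -> R^o} := [set f | continuous f].
Arguments dual {R} X.

Section subdifferential_and_coderivative.
Context {R : realType}.

(* limf_einf and limf_esup are taken along punctured filters, so the quotients
   never have a zero denominator. F may also take the value -oo away from x:
   the quotient is then -oo. *)
Definition frechet_subdiff (X : normedModType R) (F : X -> \bar R) (x : X) :
    set {linear X -> R^o} :=
  [set xs | [/\ dual X xs, F x \is a fin_num &
    (0 <= limf_einf (fun z : X =>
            (F z - F x - (xs (z - x))%:E) / `|z - x|%:E) x^')%E]].

Definition frechet_coderivative (X Y : normedModType R) (F : X -> set Y)
    (x : X) (y : Y) (ys : {linear Y -> R^o}) : set {linear X -> R^o} :=
  [set xs | dual X xs /\
    (limf_esup (fun p : X * Y =>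
       ((xs (p.1 - x) - ys (p.2 - y)) / (`|p.1 - x| + `|p.2 - y|))%:E)
     (within [set p | F p.1 p.2] ((x, y) : X * Y)^') <= 0)%E].

End subdifferential_and_coderivative.

Section continuously_differentiable.
Context {R : realType} {U : normedModType R}.

(* For linear f, the norm of f in the dual. *)
Definition dual_norm (f : U -> R) : \bar R :=
  ereal_sup [set `|f h|%:E | h in [set h : U | `|h| <= 1]].

Definition continuously_differentiable_near (J : U -> R) (u : U) : Prop :=
  \forall v \near u, differentiable J v /\
    dual_norm ('d J w \- 'd J v) @[w --> v] --> 0%E.

End continuously_differentiable.

Section selections.
Context {R : realType} {U : normedModType R} {X : Type}.
Variables (J : U -> R) (S : X -> set U).

Definition Inf_comp (x : X) : \bar R := ereal_inf [set (J u)%:E | u in S x].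
Definition Sup_comp (x : X) : \bar R := ereal_sup [set (J u)%:E | u in S x].

Definition S_sharp (x : X) : set U :=
  [set u | S x u /\ (J u)%:E = Inf_comp x].
Definition S_flat (x : X) : set U :=
  [set u | S x u /\ (J u)%:E = Sup_comp x].

End selections.

Section inner_lipschitz.
Context {R : realType} {X Y : normedModType R}.

Definition dom (F : X -> set Y) : set X := [set x | F x !=set0].

Definition dist (B : set Y) (a : Y) : \bar R :=
  ereal_inf [set `|a - b|%:E | b in B].

Definition inner_lipschitz (F : X -> set Y) (x : X) (A : set Y) : Prop :=
  forall y, A y -> exists lambda rho : R, [/\ 0 <= lambda, 0 < rho &
    forall z, ball x rho z -> dom F z ->
      (dist (F z) y <= (lambda * `|x - z|)%:E)%E].

Definition inner_semi_lipschitz (F : X -> set Y) (x : X) (A : set Y) : Prop :=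
  forall xk : nat -> X, (forall k, dom F (xk k)) -> xk @ \oo --> x ->
    exists phi : nat -> nat, {homo phi : m n / (m < n)%N} /\
    exists2 y, A y & exists2 lambda : R, 0 <= lambda &
      forall k, (dist (F (xk (phi k))) y
                 <= (lambda * `|x - xk (phi k)|)%:E)%E.

End inner_lipschitz.

(* Main.v *)
(** Both subdifferential and coderivative are read off first-order estimates
    with an error [e * |.|] valid near the base point. For (i), a minimizer [u]
    and any [v] in [S z] satisfy [Inf z - Inf x <= J v - J u], and [J] is
    differentiable at [u]. For (ii) and (iii), if [dist (S z) u <= l |x - z|],
    then [S z] contains some [v] with [|v - u| < (l + 1) |x - z|], hence
    [Sup z >= J v], while the subgradient of [J] at [u] and the coderivative at
    [(x, u)] give [J v >= Sup x + xs (z - x) - e |z - x|]. In (iii) a failure of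
    this bound would occur along a sequence tending to [x], and the estimate
    applies to the subsequence provided by the semi-Lipschitz property. *)
Require Import Defs.
From mathcomp Require Import all_boot all_order all_algebra.
From mathcomp Require Import all_classical all_reals all_analysis.
From mathcomp Require Import ring lra.
Import Order.TTheory GRing.Theory Num.Theory.
Import numFieldNormedType.Exports.
Local Open Scope classical_set_scope.
Local Open Scope ring_scope.

(** [limf_esup] is an infimum over members of the filter of suprema of [f]: a value below [e] is
    witnessed by one member, and conversely the sublevel set of [e] is itself a member. *)
Lemma limf_esup_le0P (R : realType) (T : choiceType) (X : filteredType T)
    (f : X -> \bar R) (F : set_system X) : Filter F ->
  (limf_esup f F <= 0)%E <->
  forall e : R, 0 < e -> \forall z \near F, (f z <= e%:E)%E.
Proof.
move=> FF; split=> [f0 e e0|fe].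
  have : (limf_esup f F < e%:E)%E by apply: le_lt_trans f0 _; rewrite lte_fin.
  move=> /ereal_inf_lt[_ [V FV <-]] Ve.
  apply: filterS FV => z Vz; apply: le_trans (ltW Ve).
  by apply: ereal_sup_ubound; exists z.
apply/lee_addgt0Pr => e e0; rewrite add0e.
apply: le_trans (_ : (ereal_sup (f @` [set z | (f z <= e%:E)%E]) <= _)%E).
  by apply: ereal_inf_lbound; exists [set z | (f z <= e%:E)%E] => //; exact: fe.
by apply: ge_ereal_sup => _ [z /= fz <-].
Qed.

Lemma limf_einf_ge0P (R : realType) (T : choiceType) (X : filteredType T)
    (f : X -> \bar R) (F : set_system X) : Filter F ->
  (0 <= limf_einf f F)%E <->
  forall e : R, 0 < e -> \forall z \near F, ((- e)%:E <= f z)%E.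
Proof.
move=> FF; rewrite /limf_einf oppe_ge0 limf_esup_le0P.
by split=> fe e /fe; apply: filterS => z; rewrite EFinN leeNl.
Qed.

(** Clearing the denominator is legitimate for infinite [F z] too, since [F x] is finite. At [z = x]
    the resulting inequality is an equality, so the punctured neighbourhood becomes a full one. *)
Lemma frechet_subdiffP (R : realType) (X : normedModType R) (F : X -> \bar R)
    (x : X) (xs : {linear X -> R^o}) :
  frechet_subdiff F x xs <->
  [/\ dual X xs, F x \is a fin_num & forall e : R, 0 < e ->
    \forall z \near x, (F x + (xs (z - x) - e * `|z - x|)%:E <= F z)%E].
Proof.
have H (z : X) (e : R) : F x \is a fin_num -> z != x ->
    ((- e)%:E <= (F z - F x - (xs (z - x))%:E) / `|z - x|%:E)%E =
    (F x + (xs (z - x) - e * `|z - x|)%:E <= F z)%E.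
  move=> /fineK <- zx; have n0 : 0 < `|z - x| by rewrite normr_gt0 subr_eq0.
  rewrite inver gt_eqF// lee_pdivlMr// leeBrDr// leeBrDr//.
  by rewrite -!EFinM -!EFinD; congr (_%:E <= _)%E; ring.
split=> -[xsc Fx h]; split=> //.
  move=> e e0; move: h => /limf_einf_ge0P /(_ e e0).
  rewrite /dnbhs near_withinE; apply: filterS => z hz.
  have [->|zx] := eqVneq z x.
    by rewrite subrr linear0 normr0 mulr0 subr0 adde0.
  by rewrite -H//; exact: hz.
apply/limf_einf_ge0P => e e0; rewrite /dnbhs near_withinE.
by apply: filterS (h e e0) => z hz zx; rewrite H.
Qed.

Lemma frechet_coderivativeP (R : realType) (X Y : normedModType R)
    (F : X -> set Y) (x : X) (y : Y) (ys : {linear Y -> R^o})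
    (xs : {linear X -> R^o}) :
  frechet_coderivative F x y ys xs <->
  dual X xs /\ forall e : R, 0 < e -> \forall p \near (x, y), F p.1 p.2 ->
    xs (p.1 - x) - ys (p.2 - y) <= e * (`|p.1 - x| + `|p.2 - y|).
Proof.
have H (p : X * Y) (e : R) : p != (x, y) ->
    ((xs (p.1 - x) - ys (p.2 - y)) / (`|p.1 - x| + `|p.2 - y|) <= e) =
    (xs (p.1 - x) - ys (p.2 - y) <= e * (`|p.1 - x| + `|p.2 - y|)).
  move=> pxy; rewrite ler_pdivrMr// lt_neqAle addr_ge0// andbT eq_sym.
  rewrite paddr_eq0// !normr_eq0 !subr_eq0.
  by apply: contra pxy; rewrite -xpair_eqE -surjective_pairing.
split=> -[xsc h]; split=> //.
  move=> e e0; move: h => /limf_esup_le0P /(_ e e0).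
  rewrite near_withinE /dnbhs near_withinE; apply: filterS => p hp Fp.
  have [->/=|pxy] := eqVneq p (x, y).
    by rewrite !subrr !linear0 !normr0 addr0 mulr0.
  by rewrite -H// -lee_fin; exact: hp.
apply/limf_esup_le0P => e e0; rewrite near_withinE /dnbhs near_withinE.
by apply: filterS (h e e0) => p hp pxy Fp; rewrite lee_fin H//; exact: hp.
Qed.

Lemma differentiable_near_le (R : realType) (U : normedModType R) (J : U -> R)
    (u : U) (e : R) : differentiable J u -> 0 < e ->
  \forall v \near u, `|J v - J u - 'd J u (v - u)| <= e * `|v - u|.
Proof.
move=> /diff_locallyx Ju e0.
have J0 : \forall h \near (0 : U), `|J (h + u) - J u - 'd J u h| <= e * `|h|.
  set o := (X in forall h, J (h + u) = _ + _ + X h) in Ju.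
  have /(_ e e0) : forall e, 0 < e -> \forall h \near (0 : U), `|o h| <= e * `|h|.
    exact: littleoP.
  apply: filterS => h; rewrite Ju.
  by congr (`|_| <= _); ring.
rewrite (near_shift 0); apply: filterS J0 => h /=.
by rewrite subr0 addrK.
Qed.

(** If [P] were not a neighbourhood of [x], each ball of radius [1/(k+1)] would contain a point
    outside [P]; these points converge to [x] and none lies in [P]. *)
Lemma near_seq (R : realType) (X : normedModType R) (x : X) (P : set X) :
  (forall xk : nat -> X, xk @ \oo --> x -> exists k, P (xk k)) ->
  \forall z \near x, P z.
Proof.
move=> h; apply: contrapT => nP.
have /choice[xk xkP] : forall k : nat, exists z, ball x k.+1%:R^-1 z /\ ~ P z.
  move=> k; apply: contrapT => /forallNP hk; apply: nP.
  apply/nbhs_ballP; exists k.+1%:R^-1 => /=; first by rewrite invr_gt0.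
  by move=> z xz; apply: contrapT => Pz; apply: (hk z).
have [|k] := h xk; last exact: (xkP k).2.
apply/cvgrPdist_lt => e e0; near=> k.
have := (xkP k).1; rewrite -ball_normE/= => /lt_trans; apply.
near: k; exact: near_infty_natSinv_lt (PosNum e0).
Unshelve. all: by end_near. Qed.

(** The distance bound is a premise at each single [z], so that it can be supplied on a whole ball
    in (ii) but only along a subsequence in (iii). *)
Lemma Sup_comp_near (R : realType) (U X : normedModType R) (S : X -> set U)
    (J : U -> R) (x : X) (u : U) (us : {linear U -> R^o})
    (xs : {linear X -> R^o}) (l e : R) :
  S_flat J S x u -> frechet_subdiff (EFin \o J) u us ->
  frechet_coderivative S x u us xs -> 0 <= l -> 0 < e ->
  \forall z \near x, (dist (S z) u <= (l * `|x - z|)%:E)%E ->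
    (Sup_comp J S x + (xs (z - x) - e * `|z - x|)%:E <= Sup_comp J S z)%E.
Proof.
move=> [_ JuE] /frechet_subdiffP[_ _ Ju] /frechet_coderivativeP[_ Su] l0 e0.
(* The errors total [d * (|z - x| + 2 |v - u|)], at most [d * (1 + 2 (l + 1)) |z - x|]. *)
pose d := e / (2 * l + 3).
have d0 : 0 < d by apply: divr_gt0 => //; lra.
have /nbhs_ballP[r1 /= r10 Hr1] := Ju d d0.
have /nbhs_ballP[r2 /= r20 Hr2] := Su d d0.
have l1 : 0 < l + 1 by lra.
near=> z => Sz.
have [->|zx] := eqVneq z x.
  by rewrite subrr linear0 normr0 mulr0 subr0 adde0.
have D0 : 0 < `|z - x| by rewrite normr_gt0 subr_eq0.
(* The infimum in [dist] may not be attained; enlarging [l] to [l + 1] makes the bound strict for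
   [z != x], so some [v] in [S z] satisfies it. *)
have : (dist (S z) u < ((l + 1) * `|z - x|)%:E)%E.
  by apply: le_lt_trans Sz _; rewrite lte_fin distrC ltr_pM2r//; lra.
move=> /ereal_inf_lt[_ [v Szv <-]]; rewrite lte_fin => uv.
have zr : (l + 1) * `|z - x| < Num.min r1 r2.
  rewrite -ltr_pdivlMl// distrC mulrC.
  by near: z; apply: cvgr_dist_lt => //; rewrite divr_gt0// lt_min r10.
have [uvr1 uvr2] : `|u - v| < r1 /\ `|u - v| < r2.
  by apply/andP; rewrite -lt_min; exact: lt_trans uv zr.
have xz2 : `|x - z| < r2 by near: z; exact: cvgr_dist_lt.
have Jv : J u + us (v - u) - d * `|v - u| <= J v.
  have := Hr1 v; rewrite -ball_normE /= lee_fin => /(_ uvr1).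
  by rewrite addrA.
have Sv : xs (z - x) - us (v - u) <= d * (`|z - x| + `|v - u|).
  by apply: (Hr2 (z, v)) => //; split; rewrite -ball_normE.
apply: (@le_trans _ _ (J v)%:E); last by apply: ereal_sup_ubound; exists v.
rewrite -JuE -EFinD lee_fin; rewrite distrC in uv.
have -> : e = d * (2 * l + 3) by rewrite divfK// gt_eqF//; lra.
have : d * `|v - u| <= d * ((l + 1) * `|z - x|) by rewrite ler_pM2l// ltW.
by lra.
Unshelve. all: by end_near. Qed.

Lemma leq_homo_ltn (phi : nat -> nat) :
  {homo phi : m n / (m < n)%N} -> forall n, (n <= phi n)%N.
Proof.
move=> phi_lt; elim=> // n IHn.
by apply: leq_ltn_trans IHn _; exact: phi_lt.
Qed.

Theorem theorem2p6 (R : realType) (U X : normedModType R)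
    (S : X -> set U) (J : U -> R) (x : X) :
  [/\ (* (i) *)
      S_sharp J S x !=set0 ->
      (forall u, S_sharp J S x u -> continuously_differentiable_near J u) ->
      frechet_subdiff (Inf_comp J S) x `<=`
        \bigcap_(u in S_sharp J S x) frechet_coderivative S x u ('d J u),
      (* (ii) *)
      forall A : set U, (forall z, S z !=set0) -> A `<=` S_flat J S x ->
      inner_lipschitz S x A ->
      \bigcup_(u in A) \bigcup_(us in frechet_subdiff (EFin \o J) u)
          frechet_coderivative S x u us
        `<=` frechet_subdiff (Sup_comp J S) x
    & (* (iii) *)
      forall A : set U, (forall z, S z !=set0) -> A `<=` S_flat J S x ->
      inner_semi_lipschitz S x A ->
      \bigcap_(u in A) \bigcup_(us in frechet_subdiff (EFin \o J) u)
          frechet_coderivative S x u us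
        `<=` frechet_subdiff (Sup_comp J S) x].
Proof.
split.
- move=> _ Jdiff xs /frechet_subdiffP[xsc _ Infx] u Su.
  have Ju : differentiable J u by have /nbhs_singleton[] := Jdiff u Su.
  apply/frechet_coderivativeP; split=> // e e0.
  have [_ JuE] := Su.
  near=> p => Sp.
  (* The error at [p.1] comes from the subgradient and the one at [p.2] from differentiability; they
     add up to the error allowed in the coderivative. *)
  have InfJ : J u + (xs (p.1 - x) - e * `|p.1 - x|) <= J p.2.
    rewrite -lee_fin EFinD JuE.
    apply: le_trans (_ : (_ <= Inf_comp J S p.1)%E) _.
      by near: p; exact: (cvg_fst (Infx e e0)).
    by apply: ereal_inf_lbound; exists p.2.
  have : `|J p.2 - J u - 'd J u (p.2 - u)| <= e * `|p.2 - u|.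
    by near: p; exact: (cvg_snd (differentiable_near_le _ _ _ _ _ Ju e0)).
  by move=> /ler_normlP[]; lra.
- move=> A S0 AS lipS xs [u Au [us Jus Sus]].
  have [l [r [l0 r0 Sl]]] := lipS u Au.
  apply/frechet_subdiffP; split.
  + by have [] := Sus.
  + by have [_ <-] := AS u Au.
  + move=> e e0; near=> z.
    have xz : ball x r z by near: z; exact: nbhsx_ballx.
    move: (Sl z xz (S0 z)); near: z.
    exact: (Sup_comp_near _ _ _ _ _ _ _ _ _ _ _ (AS _ Au) Jus Sus l0 e0).
- move=> A S0 AS lipS xs xsA.
  (* An intersection over an empty [A] would say nothing about [xs]; the constant sequence at [x]
     yields a point of [A]. *)
  have [u Au] : exists u, A u.
    have [|_ [_ [u Au _]]] := lipS (cst x) (fun=> S0 x); first exact: cvg_cst.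
    by exists u.
  apply/frechet_subdiffP; split.
  + by have [us _ []] := xsA u Au.
  + by have [_ <-] := AS u Au.
  + move=> e e0; apply: near_seq => xk xkx.
    (* The point [v], and with it the neighbourhood given by [Sup_comp_near], depends on the
       sequence. The subsequence eventually enters that neighbourhood, and one such index suffices
       for [near_seq]. *)
    have [phi [phi_lt [v Av [l l0 Sl]]]] := lipS xk (fun k => S0 _) xkx.
    have [us Jus Sus] := xsA v Av.
    have phioo : phi @ \oo --> \oo.
      move=> B [N _ NB]; exists N => // n /= Nn; apply: NB => /=.
      exact: (leq_trans Nn (leq_homo_ltn _ phi_lt n)).
    have := cvg_comp _ _ phioo xkx.
    move=> /(_ _ (Sup_comp_near _ _ _ _ _ _ _ _ _ _ _ (AS _ Av) Jus Sus l0 e0))[N _ HN].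
    by exists (phi N); apply: HN => /=; [exact: leqnn|exact: Sl].
Unshelve. all: by end_near. Qed.
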